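(* Let $m_1,m_2,m_3>0$ and $h\in\mathbb{R}$. The regularised 3-body Hamiltonian \begin{align*} H=\;&\tfrac18\Big(\tfrac{R_{12}R_{31}}{\mu_{23}}\boldsymbol{P}_{23}^T\boldsymbol{P}_{23}+\tfrac{R_{12}R_{23}}{\mu_{31}}\boldsymbol{P}_{31}^T\boldsymbol{P}_{31}+\tfrac{R_{23}R_{31}}{\mu_{12}}\boldsymbol{P}_{12}^T\boldsymbol{P}_{12}\Big)\\ &-\tfrac14\Big(\tfrac{R_{23}}{m_1}(\boldsymbol{Q}_{31}*\boldsymbol{P}_{31}^\star)^T(\boldsymbol{Q}_{12}*\boldsymbol{P}_{12}^\star)+\tfrac{R_{31}}{m_2}(\boldsymbol{Q}_{12}*\boldsymbol{P}_{12}^\star)^T(\boldsymbol{Q}_{23}*\boldsymbol{P}_{23}^\star)+\tfrac{R_{12}}{m_3}(\boldsymbol{Q}_{23}*\boldsymbol{P}_{23}^\star)^T(\boldsymbol{Q}_{31}*\boldsymbol{P}_{31}^\star)\Big)\\ &-(m_2m_3R_{31}R_{12}+m_3m_1R_{12}R_{23}+m_1m_2R_{23}R_{31})-hR_{23}R_{31}R_{12} \end{align*} on $T^*\mathbb{R}^{12}$ can be written as a polynomial in the quadratic forms on $T^*\mathbb{R}^{12}$ that are invariant under the diagonal action $\Psi_S$, $S\in G$.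
   Context: Here $\boldsymbol{Q}_{ij},\boldsymbol{P}_{ij}\in\mathbb{R}^4$ for $ij\in\{12,23,31\}$ are the coordinates on $T^*\mathbb{R}^{12}$; a vector $(Q_0,Q_1,Q_2,Q_3)$ is identified with the quaternion $Q_0+\boldsymbol{i}Q_1+\boldsymbol{j}Q_2+\boldsymbol{k}Q_3$, $*$ is quaternion multiplication, and $^\star$ flips the sign of the $\boldsymbol{k}$-component: $\boldsymbol{Q}^\star=Q_0+\boldsymbol{i}Q_1+\boldsymbol{j}Q_2-\boldsymbol{k}Q_3$. In $(\cdot)^T(\cdot)$ quaternions are regarded as vectors in $\mathbb{R}^4$. Moreover $R_{ij}=\boldsymbol{Q}_{ij}^T\boldsymbol{Q}_{ij}$ and $\mu_{ij}=\frac{m_im_j}{m_i+m_j}$. Let $$K=\begin{pmatrix}0&0&0&-1\\0&0&1&0\\0&-1&0&0\\1&0&0&0\end{pmatrix},\qquad \operatorname{Isoc}(\hat{\boldsymbol L})=\begin{pmatrix}\hat{\boldsymbol L}&-\boldsymbol L\\ \boldsymbol L^{t}&0\end{pmatrix}\quad(\boldsymbol L\in\mathbb{R}^3),$$ where $\hat{\boldsymbol L}$ is the skew $3\times3$ matrix with $\hat{\boldsymbol L}\boldsymbol v=\boldsymbol L\times\boldsymbol v$. Let $G\subset SO(4)$ be the subgroup of all matrices $\exp\!\big(\tfrac12(\operatorname{Isoc}(\hat{\boldsymbol L})+\tau K)\big)$, $\boldsymbol L\in\mathbb{R}^3$, $\tau\in\mathbb{R}$. For $S\in G$ the diagonal action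 $\Psi_S$ replaces every $\boldsymbol{Q}_{ij}$ by $S\boldsymbol{Q}_{ij}$ and every $\boldsymbol{P}_{ij}$ by $S\boldsymbol{P}_{ij}$. *)

(* Defs.v *)
From HB Require Import structures.
From mathcomp Require Import all_boot all_order all_algebra.
From mathcomp Require Import all_classical all_reals all_analysis.
From mathcomp Require mpoly.

Set Implicit Arguments.
Unset Strict Implicit.
Unset Printing Implicit Defensive.

Import Order.TTheory GRing.Theory Num.Theory.
Import numFieldNormedType.Exports.

Local Open Scope classical_set_scope.
Local Open Scope ring_scope.

(* A point (Q, P) of T^*R^12: the columns of each 4 x 3 matrix are the vectors
   with index 12, 23, 31, in this order. *)
Notation phase R := ('M[R]_(4, 3) * 'M[R]_(4, 3))%type.

Section Definitions.
Variable R : realType.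

Definition dot (u v : 'cV[R]_4) : R := (u^T *m v) 0 0.

Definition quat (a b c d : R) : 'cV[R]_4 :=
  \col_(i < 4) nth 0 [:: a; b; c; d] i.

(* The Hamilton product, (Q0, Q1, Q2, Q3) standing for Q0 + i Q1 + j Q2 + k Q3. *)
Definition qmul (p q : 'cV[R]_4) : 'cV[R]_4 :=
  let p0 := p (inord 0) 0 in let p1 := p (inord 1) 0 in
  let p2 := p (inord 2) 0 in let p3 := p (inord 3) 0 in
  let q0 := q (inord 0) 0 in let q1 := q (inord 1) 0 in
  let q2 := q (inord 2) 0 in let q3 := q (inord 3) 0 in
  quat (p0 * q0 - p1 * q1 - p2 * q2 - p3 * q3)
       (p0 * q1 + p1 * q0 + p2 * q3 - p3 * q2)
       (p0 * q2 - p1 * q3 + p2 * q0 + p3 * q1)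
       (p0 * q3 + p1 * q2 - p2 * q1 + p3 * q0).

Definition qstar (q : 'cV[R]_4) : 'cV[R]_4 :=
  quat (q (inord 0) 0) (q (inord 1) 0) (q (inord 2) 0) (- q (inord 3) 0).

Definition Q12 (z : phase R) : 'cV[R]_4 := col (inord 0) z.1.
Definition Q23 (z : phase R) : 'cV[R]_4 := col (inord 1) z.1.
Definition Q31 (z : phase R) : 'cV[R]_4 := col (inord 2) z.1.
Definition P12 (z : phase R) : 'cV[R]_4 := col (inord 0) z.2.
Definition P23 (z : phase R) : 'cV[R]_4 := col (inord 1) z.2.
Definition P31 (z : phase R) : 'cV[R]_4 := col (inord 2) z.2.

Definition red_mass (ma mb : R) : R := ma * mb / (ma + mb).

Definition hamiltonian (m1 m2 m3 h : R) (z : phase R) : R :=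
  let R12 := dot (Q12 z) (Q12 z) in
  let R23 := dot (Q23 z) (Q23 z) in
  let R31 := dot (Q31 z) (Q31 z) in
  let W12 := qmul (Q12 z) (qstar (P12 z)) in
  let W23 := qmul (Q23 z) (qstar (P23 z)) in
  let W31 := qmul (Q31 z) (qstar (P31 z)) in
  8^-1 * (R12 * R31 / red_mass m2 m3 * dot (P23 z) (P23 z)
          + R12 * R23 / red_mass m3 m1 * dot (P31 z) (P31 z)
          + R23 * R31 / red_mass m1 m2 * dot (P12 z) (P12 z))
  - 4^-1 * (R23 / m1 * dot W31 W12
            + R31 / m2 * dot W12 W23
            + R12 / m3 * dot W23 W31)
  - (m2 * m3 * R31 * R12 + m3 * m1 * R12 * R23 + m1 * m2 * R23 * R31)
  - h * R23 * R31 * R12.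

Definition matrix_of_rows m n (s : seq (seq R)) : 'M[R]_(m, n) :=
  \matrix_(i < m, j < n) nth 0 (nth [::] s i) j.

Definition Kmx : 'M[R]_4 := matrix_of_rows 4 4
  [:: [:: 0; 0; 0; -1];
      [:: 0; 0; 1; 0];
      [:: 0; -1; 0; 0];
      [:: 1; 0; 0; 0]].

(* The skew matrix such that hat L *m v is the cross product of L and v. *)
Definition hat (L : 'cV[R]_3) : 'M[R]_3 :=
  let L1 := L (inord 0) 0 in let L2 := L (inord 1) 0 in
  let L3 := L (inord 2) 0 in
  matrix_of_rows 3 3
  [:: [:: 0; - L3; L2];
      [:: L3; 0; - L1];
      [:: - L2; L1; 0]].

Definition Isoc (L : 'cV[R]_3) : 'M[R]_4 :=
  block_mx (hat L) (- L) L^T (0 : 'M[R]_1).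

(* The limit is taken in the normed space of 4 x 4 matrices. *)
Definition expmx (A : 'M[R]_4) : 'M[R]_4 :=
  lim (series (fun k : nat => k`!%:R^-1 *: A ^+ k) @ \oo).

Definition G : set 'M[R]_4 :=
  [set S | exists (L : 'cV[R]_3) (tau : R),
     S = expmx (2^-1 *: (Isoc L + tau *: Kmx))].

Definition Psi (S : 'M[R]_4) (z : phase R) : phase R := (S *m z.1, S *m z.2).

Definition quadratic_form (q : phase R -> R) : Prop :=
  exists B : {biscalar phase R}, forall z, q z = B z z.

Definition Psi_invariant (q : phase R -> R) : Prop :=
  forall S, G S -> forall z, q (Psi S z) = q z.

End Definitions.

(* Main.v *)
(* In quaternions, Isoc L is a left multiplication and K is the right
   multiplication by k, so the generators A of G are skew and commute with K.
   If A^T M + M A = 0 then exp(tA)^T M exp(tA) is constant in t; hence the forms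
   u^T v and u^T K v in the columns u, v of (Q, P) are invariant under G. The
   factors a * p^star of the kinetic cross terms are not invariant, but the
   products (a * p^star)^T (b * q^star) are quadratic polynomials in these
   forms. *)
From HB Require Import structures.
Require Import Defs.
From mathcomp Require Import all_boot all_order all_algebra ring.
From mathcomp Require Import all_classical all_reals all_analysis.
From mathcomp Require mpoly.
Import (canonicals) mpoly.
Set Implicit Arguments.
Unset Strict Implicit.
Unset Printing Implicit Defensive.

Import Order.TTheory GRing.Theory Num.Theory.
Import numFieldNormedType.Exports.
Local Open Scope classical_set_scope.
Local Open Scope ring_scope.

(** * The matrix exponential through scalar power series, and the bilinear forms it preserves *)

Section MatrixExponential.
Context {R : realType}.

(** The matrix norm is a maximum over finitely many entries, so finitely many entrywise
    neighbourhoods can be intersected. *)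
Lemma cvg_mx m n (M : nat -> 'M[R]_(m, n)) (l : 'M[R]_(m, n)) :
  (forall i j, (fun k => M k i j) @ \oo --> l i j) -> M @ \oo --> l.
Proof.
move=> Ml; apply/cvgrPdist_le => e e0.
near=> k.
rewrite /Num.Def.normr/= mx_normrE (bigmax_le _ (ltW e0))//= => i _.
rewrite !mxE; move: i; near: k; apply: filter_forall => /= i.
exact: ((cvgrPdist_le _ _).1 (Ml i.1 i.2)).
Unshelve. all: by end_near. Qed.

Variable n : nat.
Implicit Types A B M : 'M[R]_n.+1.

(* The factor B makes the family of coefficients closed under differentiation. *)
Definition expmx_coef A B (i j : 'I_n.+1) (k : nat) : R :=
  k`!%:R^-1 * (B *m A ^+ k) i j.

(** An entry of B exp(tA), kept as a real power series in [t] so that termwise differentiation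
    applies. *)
Definition expmx_entry A B (i j : 'I_n.+1) (t : R) : R :=
  limn (pseries (expmx_coef A B i j) t).

Let entry_sum A : R := \sum_i \sum_j `|A i j|.

Let entry_le A i j : `|A i j| <= entry_sum A.
Proof.
rewrite /entry_sum (bigD1 i)//= (bigD1 j)//= -addrA lerDl addr_ge0//.
  exact: sumr_ge0.
by apply: sumr_ge0 => k _; exact: sumr_ge0.
Qed.

Let col_sum_le A j : \sum_i `|A i j| <= entry_sum A.
Proof.
apply: ler_sum => i _; rewrite (bigD1 j)//= lerDl.
exact: sumr_ge0.
Qed.

(** Each further factor [A] costs at most a column sum of absolute values, which [entry_sum A]
    dominates. *)
Lemma expmx_entry_bound A B i j k :
  `|(B *m A ^+ k) i j| <= entry_sum B * entry_sum A ^+ k.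
Proof.
elim: k i j => [|k IH] i j; first by rewrite expr0 mulmx1 mulr1.
have b0 : 0 <= entry_sum B * entry_sum A ^+ k := le_trans (normr_ge0 _) (IH i j).
rewrite exprSr mulmxA mxE (le_trans (ler_norm_sum _ _ _))//.
apply: (@le_trans _ _ (\sum_l entry_sum B * entry_sum A ^+ k * `|A l j|)).
  by apply: ler_sum => l _; rewrite normrM ler_wpM2r.
by rewrite -mulr_sumr exprSr [leRHS]mulrA ler_wpM2l.
Qed.

(** Absolute convergence, by comparison with a multiple of the real exponential series at
    [entry_sum A * |t|]. *)
Lemma is_cvg_expmx_coef A B i j t : cvgn (pseries (expmx_coef A B i j) t).
Proof.
apply: normed_cvg; rewrite /normed_series_of /=.
apply: (@series_le_cvg _ _
  (entry_sum B *: exp_coeff (entry_sum A * `|t|))) => [//|k||].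
- rewrite mulr_ge0// ?exp_coeff_ge0// ?mulr_ge0//;
    by apply: sumr_ge0 => ? _; exact: sumr_ge0.
- move=> k; rewrite /expmx_coef !normrM normrX.
  rewrite [`|_^-1|]ger0_norm ?invr_ge0//.
  rewrite [leRHS](_ : _ =
    k`!%:R^-1 * (entry_sum B * entry_sum A ^+ k) * `|t| ^+ k).
    by rewrite ler_wpM2r ?exprn_ge0// ler_wpM2l ?invr_ge0// expmx_entry_bound.
  change (entry_sum B * ((entry_sum A * `|t|) ^+ k / k`!%:R) =
    k`!%:R^-1 * (entry_sum B * entry_sum A ^+ k) * `|t| ^+ k).
  rewrite exprMn; ring.
- by apply: is_cvg_seriesZ; exact: is_cvg_series_exp_coeff.
Qed.

(** The factor [k + 1] cancels in [(k + 1)!], and the extra power of [A] is absorbed into [B]. *)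
Lemma pseries_diffs_expmx_coef A B i j :
  pseries_diffs (expmx_coef A B i j) = expmx_coef A (B *m A) i j.
Proof.
apply/funext => k; rewrite /pseries_diffs /expmx_coef factS natrM invfM.
by rewrite exprS mulmxA !mulrA mulfV ?pnatr_eq0// mul1r.
Qed.

Lemma is_derive_expmx_entry A B i j (t : R) :
  is_derive t (1 : R) (expmx_entry A B i j) (expmx_entry A (B *m A) i j t).
Proof.
rewrite /expmx_entry -pseries_diffs_expmx_coef.
(* The series and its derived series converge everywhere, so any point beyond [|t|] would serve. *)
apply: (@pseries_snd_diffs _ _ (`|t| + 1));
  rewrite ?pseries_diffs_expmx_coef; try exact: is_cvg_expmx_coef.
by rewrite [ltRHS]ger0_norm ?ltrDl// addr_ge0.
Qed.

Lemma expmx_entry0 A B i j : expmx_entry A B i j 0 = B i j.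
Proof.
(* At [t = 0] the partial sums are constant from one term on, with [0 ^+ 0 = 1]; only the empty sum
   differs. *)
apply/cvg_lim => //; apply: cvg_near_cst; exists 1%N => // k /= k0.
rewrite /pseries /series /= -(prednK k0) big_nat_recl//= big1 => [|l _].
  by rewrite /expmx_coef invr1 mul1r expr0 mulmx1 addr0 mulr1.
by rewrite expr0n/= mulr0.
Qed.

Lemma expmx_entryE A B i j t :
  expmx_entry A B i j t = \sum_l B i l * expmx_entry A 1%:M l j t.
Proof.
apply/cvg_lim => //.
have -> : pseries (expmx_coef A B i j) t =
    \sum_l (fun k => B i l * pseries (expmx_coef A 1%:M l j) t k).
  apply/funext => k; rewrite fct_sumE /pseries /series /=.
  under [RHS]eq_bigr do rewrite mulr_sumr.
  rewrite exchange_big /=; apply: eq_bigr => r _.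
  rewrite /expmx_coef mxE mulr_sumr mulr_suml; apply: eq_bigr => l _.
  by rewrite mul1mx; ring.
elim/big_ind2 : _ => [|u a v b ua vb|l _]; first exact: cvg_cst.
  exact: cvgD.
by apply: cvgMr; exact: is_cvg_expmx_coef.
Qed.

Definition expmx_path A (t : R) : 'M[R]_n.+1 :=
  \matrix_(i, j) expmx_entry A 1%:M i j t.

Lemma expmx_entry_mulmx A B i j t :
  expmx_entry A B i j t = (B *m expmx_path A t) i j.
Proof.
by rewrite expmx_entryE mxE; apply: eq_bigr => l _; rewrite mxE.
Qed.

Lemma expmx_path0 A : expmx_path A 0 = 1%:M.
Proof. by apply/matrixP => i j; rewrite mxE expmx_entry0. Qed.

Lemma expmx_path_preserves A M t : A^T *m M + M *m A = 0 ->
  (expmx_path A t)^T *m M *m expmx_path A t = M.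
Proof.
move=> AM; apply/matrixP => i j.
pose e k l := expmx_entry A 1%:M k l.
pose F s := ((expmx_path A s)^T *m M *m expmx_path A s) i j.
(* Finite sums of products and scalings: a form whose derivative is found by instance inference. *)
have FE : F = \sum_k \sum_l (e l i * (M l k *: e k j)).
  apply/funext => s; rewrite /F mxE fct_sumE; apply: eq_bigr => k _.
  rewrite mxE fct_sumE mulr_suml; apply: eq_bigr => l _.
  by rewrite !mxE -mulrA.
suff /(is_derive_0_is_cst t 0) : forall s, is_derive s (1 : R) F 0.
  by rewrite /F expmx_path0 trmx1 mul1mx mulmx1.
move=> s.
have eA k l : is_derive s (1 : R) (e k l) ((A *m expmx_path A s) k l).
  rewrite -expmx_entry_mulmx -[X in expmx_entry A X]mul1mx.
  exact: is_derive_expmx_entry.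
rewrite FE; apply: is_derive_eq.
(* With E = exp(sA), the product rule gives (AE)^T M E + E^T M (AE) = E^T (A^T M + M A) E, which
   vanishes. *)
transitivity (((A *m expmx_path A s)^T *m M *m expmx_path A s
  + (expmx_path A s)^T *m M *m (A *m expmx_path A s)) i j); last first.
  rewrite trmx_mul -!mulmxA -mulmxDr [X in _ *m (_ + X)]mulmxA.
  by rewrite [X in _ *m (X + _)]mulmxA -mulmxDl AM mul0mx mulmx0 mxE.
rewrite 3!mxE -big_split /=; apply: eq_bigr => k _.
rewrite [X in X * _ + _]mxE [X in _ + X * _]mxE [expmx_path A s k j]mxE.
rewrite !mulr_suml -big_split /=; apply: eq_bigr => l _.
rewrite ![(_^T)%R _ _]mxE [expmx_path A s l i]mxE.
change ((M l k *: e k j) s) with (M l k * e k j s).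
rewrite /e /GRing.scale /=; ring.
Qed.

End MatrixExponential.

Lemma expmxE {R : realType} (A : 'M[R]_4) : expmx A = expmx_path A 1.
Proof.
apply: (@cvg_lim 'M[R]_4); first exact: norm_hausdorff.
apply: cvg_mx => i j; rewrite mxE.
have -> : (fun k => series (fun k => k`!%:R^-1 *: A ^+ k) k i j) =
    pseries (expmx_coef A 1%:M i j) 1.
  apply/funext => k; rewrite /pseries /series /= summxE.
  by apply: eq_bigr => l _; rewrite /expmx_coef mxE mul1mx expr1n mulr1.
exact: is_cvg_expmx_coef.
Qed.

Lemma expmx_preserves {R : realType} (A M : 'M[R]_4) :
  A^T *m M + M *m A = 0 -> (expmx A)^T *m M *m expmx A = M.
Proof. by rewrite expmxE; exact: expmx_path_preserves. Qed.

(** * The generators of [G]: skewness and commutation with [Kmx] *)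

Section Generators.
Context {R : realType}.
Implicit Types (L : 'cV[R]_3) (tau : R).

(** The explicit entries reduce later identities to entrywise checks; they are those of left
    multiplication by [L3 i - L2 j + L1 k], as the first column shows. *)
Lemma IsocE L :
  let L1 := L (inord 0) 0 in let L2 := L (inord 1) 0 in
  let L3 := L (inord 2) 0 in
  Isoc L = matrix_of_rows 4 4
    [:: [:: 0; - L3; L2; - L1];
        [:: L3; 0; - L1; - L2];
        [:: - L2; L1; 0; - L3];
        [:: L1; L2; L3; 0]].
Proof.
apply/matrixP => i j; rewrite /Isoc [RHS]mxE.
case: (@split_ordP 3 1 i) => {}i ->;
  case: (@split_ordP 3 1 j) => {}j ->.
- rewrite [LHS](@block_mxEul _ 3 1 3 1) mxE.
  by case: i => [[|[|[|//]]] ?]; case: j => [[|[|[|//]]] ?].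
- rewrite [LHS](@block_mxEur _ 3 1 3 1) mxE (ord1 j) /=.
  case: i => [[|[|[|//]]] ?] /=; congr (- L _ _);
    by apply: val_inj; rewrite /= inordK.
- rewrite [LHS](@block_mxEdl _ 3 1 3 1) mxE (ord1 i) /=.
  case: j => [[|[|[|//]]] ?] /=; congr (L _ _);
    by apply: val_inj; rewrite /= inordK.
- by rewrite [LHS](@block_mxEdr _ 3 1 3 1) mxE (ord1 i) (ord1 j).
Qed.

Lemma trmx_generator L tau :
  (2^-1 *: (Isoc L + tau *: Kmx R))^T = - (2^-1 *: (Isoc L + tau *: Kmx R)).
Proof.
rewrite IsocE; apply/matrixP => i j; rewrite !mxE.
by case: i => [[|[|[|[|//]]]] ?]; case: j => [[|[|[|[|//]]]] ?] /=; ring.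
Qed.

Lemma Isoc_Kmx_comm L : Isoc L *m Kmx R = Kmx R *m Isoc L.
Proof.
rewrite IsocE; apply/matrixP => i j; rewrite !mxE !big_ord_recl !big_ord0 !mxE.
by case: i => [[|[|[|[|//]]]] ?]; case: j => [[|[|[|[|//]]]] ?] /=; ring.
Qed.

End Generators.

(** * Invariant quadratic forms and the identity for the kinetic cross terms *)

Section InvariantForms.
Context {R : realType}.
Implicit Types (M S : 'M[R]_4) (z w : phase R) (s t : bool * 'I_3).

(** One index for all six columns lets a single family of forms pair positions and momenta alike. *)
Definition phase_col z s : 'cV[R]_4 := col s.2 (if s.1 then z.2 else z.1).

Lemma phase_col_linear a z w s :
  phase_col (a *: z + w) s = a *: phase_col z s + phase_col w s.
Proof. by rewrite -linearP; case: s => [[] i]. Qed.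

Lemma phase_col_Psi S z s : phase_col (Psi S z) s = S *m phase_col z s.
Proof. by case: s => [[] i]; rewrite /phase_col /= !colE mulmxA. Qed.

(** Two separate phase points make this bilinear; the quadratic form is its restriction to the
    diagonal. *)
Definition col_form M s t z w : R :=
  ((phase_col z s)^T *m M *m phase_col w t) 0 0.

Fact col_form_bilinear M s t :
  bilinear_for *%R *%R (col_form M s t).
Proof.
split=> w a u v; rewrite /col_form phase_col_linear.
  by rewrite linearP /= !mulmxDl -!scalemxAl !mxE.
by rewrite mulmxDr -scalemxAr !mxE.
Qed.

HB.instance Definition _ M s t :=
  bilinear_isBilinear.Build R (phase R) (phase R) R *%R *%R
    (col_form M s t) (col_form_bilinear M s t).

Lemma quadratic_col_form M s t : quadratic_form (fun z => col_form M s t z z).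
Proof. by exists (col_form M s t). Qed.

(** [M] commutes with the generator [A], and [A] is skew, so A^T M + M A = 0. *)
Lemma invariant_col_form M s t : Kmx R *m M = M *m Kmx R ->
  (forall L, Isoc L *m M = M *m Isoc L) ->
  Psi_invariant (fun z => col_form M s t z z).
Proof.
move=> KM IM S [L [tau ->]] z; set A := _ *: _.
have AM : A *m M = M *m A.
  by rewrite -scalemxAl -scalemxAr mulmxDl mulmxDr IM -scalemxAl -scalemxAr KM.
rewrite /col_form !phase_col_Psi trmx_mul.
rewrite -[in RHS](@expmx_preserves _ A M) ?mulmxA//.
by rewrite trmx_generator mulNmx AM addNr.
Qed.

(** The index type is finite, with 2 * 6 * 6 = 72 elements, as a polynomial ring in finitely many
    variables requires. *)
Definition basic_form (x : bool * (bool * 'I_3) * (bool * 'I_3)) z : R :=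
  col_form (if x.1.1 then Kmx R else 1%:M) x.1.2 x.2 z z.

Lemma quadratic_basic_form x : quadratic_form (basic_form x).
Proof. exact: quadratic_col_form. Qed.

Lemma invariant_basic_form x : Psi_invariant (basic_form x).
Proof.
apply: invariant_col_form => [|L]; case: x.1.1; rewrite ?mulmx1 ?mul1mx//.
exact: Isoc_Kmx_comm.
Qed.

(** The skew form pairing [u] with [v * k]; with [dot] it makes up the Hermitian product for the
    complex structure [Kmx]. *)
Definition dotK (u v : 'cV[R]_4) : R := (u^T *m Kmx R *m v) 0 0.

Lemma dot_phase_col s t z :
  dot (phase_col z s) (phase_col z t) = basic_form (false, s, t) z.
Proof. by rewrite /basic_form /col_form mulmx1. Qed.

Fact inord4E : [/\ inord 0 = ord0 :> 'I_4, inord 1 = lift ord0 ord0 :> 'I_4,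
  inord 2 = lift ord0 (lift ord0 ord0) :> 'I_4
  & inord 3 = lift ord0 (lift ord0 (lift ord0 ord0)) :> 'I_4].
Proof. by split; apply: val_inj; rewrite /= inordK. Qed.

Lemma dotE (u v : 'cV[R]_4) :
  dot u v = u (inord 0) 0 * v (inord 0) 0 + u (inord 1) 0 * v (inord 1) 0
    + u (inord 2) 0 * v (inord 2) 0 + u (inord 3) 0 * v (inord 3) 0.
Proof.
have [-> -> -> ->] := inord4E.
by rewrite /dot mxE !big_ord_recl big_ord0 !mxE addr0 !addrA.
Qed.

Lemma dotKE (u v : 'cV[R]_4) :
  dotK u v = u (inord 3) 0 * v (inord 0) 0 - u (inord 2) 0 * v (inord 1) 0
    + u (inord 1) 0 * v (inord 2) 0 - u (inord 0) 0 * v (inord 3) 0.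
Proof.
have [-> -> -> ->] := inord4E.
rewrite /dotK mxE !big_ord_recl !big_ord0 !mxE !big_ord_recl !big_ord0 !mxE /=.
ring.
Qed.

(* The k-conjugation star gives a * p^star = (a k^-1 conj(p)) k, so the left side
   is the real part of (conj(b) a) k^-1 (conj(p) q) k. Under right multiplication
   by e^(k t), the i, j components of conj(b) a and conj(p) q rotate together;
   their pairing is the two-dimensional complex Gram determinant, which
   contributes the last four terms. *)
Lemma dot_qmul_qstar (a p b q : 'cV[R]_4) :
  dot (qmul a (qstar p)) (qmul b (qstar q)) =
  dot a b * dot p q + dotK a b * dotK p q
  - dot a p * dot b q + dotK a p * dotK b q
  + dot a q * dot b p - dotK a q * dotK b p.
Proof.
rewrite !dotE !dotKE /qmul /qstar /quat !mxE !inordK//=.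
ring.
Qed.

End InvariantForms.

(** * Functions that are polynomials in given functions *)

Section PolynomialIn.
Context {R : comNzRingType} {X : Type} {n : nat}.
Variable q : 'I_n -> X -> R.
Implicit Types f g : X -> R.

(** Closure under the ring operations yields the polynomial for the Hamiltonian without writing it
    out. *)
Definition polynomial_in f :=
  exists p : mpoly.mpoly n R, forall x, f x = mpoly.meval (q^~ x) p.

Lemma polynomial_in_gen i : polynomial_in (q i).
Proof. by exists (mpoly.mpolyX R (mpoly.mnm1 i)) => x; rewrite mpoly.mevalXU. Qed.

Lemma polynomial_in_const c : polynomial_in (fun=> c).
Proof. by exists (mpoly.mpolyC n c) => x; rewrite mpoly.mevalC. Qed.

Lemma polynomial_inD f g : polynomial_in f -> polynomial_in g ->
  polynomial_in (fun x => f x + g x).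
Proof.
by move=> [p fp] [r gr]; exists (p + r) => x; rewrite mpoly.mevalD fp gr.
Qed.

Lemma polynomial_inN f : polynomial_in f -> polynomial_in (fun x => - f x).
Proof. by move=> [p fp]; exists (- p) => x; rewrite mpoly.mevalN fp. Qed.

Lemma polynomial_inM f g : polynomial_in f -> polynomial_in g ->
  polynomial_in (fun x => f x * g x).
Proof.
by move=> [p fp] [r gr]; exists (p * r) => x; rewrite mpoly.mevalM fp gr.
Qed.

End PolynomialIn.

Theorem mainTheorem4 (R : realType) (m1 m2 m3 h : R)
    (hm1 : 0 < m1) (hm2 : 0 < m2) (hm3 : 0 < m3) :
  exists (n : nat) (q : 'I_n -> phase R -> R) (p : mpoly.mpoly n R),
    (forall i, quadratic_form (q i) /\ Psi_invariant (q i)) /\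
    forall z : phase R,
      hamiltonian m1 m2 m3 h z = mpoly.meval (fun i => q i z) p.
Proof.
(* The variables enumerate the index type of the basic forms; [enum_rank] recovers the variable of a
   given form. *)
pose q (i : 'I_#|{: bool * (bool * 'I_3) * (bool * 'I_3)}|) :=
  @basic_form R (enum_val i).
exists _, q.
suff [p Hp] : polynomial_in q (hamiltonian m1 m2 m3 h).
  exists p; split=> // i; split; [exact: quadratic_basic_form|].
  exact: invariant_basic_form.
have q_basic x : polynomial_in q (basic_form x).
  by rewrite -(enum_rankK x); exact: polynomial_in_gen.
have q_dot s t : polynomial_in q (fun z => dot (phase_col z s) (phase_col z t)).
  by under eq_fun do rewrite dot_phase_col; exact: q_basic.
have q_dotK s t :
    polynomial_in q (fun z => dotK (phase_col z s) (phase_col z t)).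
  exact: (q_basic (true, s, t)).
have q_dot_W s t s' t' : polynomial_in q (fun z =>
    dot (qmul (phase_col z s) (qstar (phase_col z t)))
        (qmul (phase_col z s') (qstar (phase_col z t')))).
  under eq_fun do rewrite dot_qmul_qstar.
  by do ![exact: q_dot | exact: q_dotK
    | apply: polynomial_inD | apply: polynomial_inN | apply: polynomial_inM].
rewrite /hamiltonian.
rewrite (_ : @Q12 R = phase_col^~ (false, inord 0))//.
rewrite (_ : @Q23 R = phase_col^~ (false, inord 1))//.
rewrite (_ : @Q31 R = phase_col^~ (false, inord 2))//.
rewrite (_ : @P12 R = phase_col^~ (true, inord 0))//.
rewrite (_ : @P23 R = phase_col^~ (true, inord 1))//.
rewrite (_ : @P31 R = phase_col^~ (true, inord 2))//=.
(* Every division is by masses or numbers, so the inverses enter as constants. *)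
by do ![exact: q_dot | exact: q_dot_W | exact: polynomial_in_const
  | apply: polynomial_inD | apply: polynomial_inN | apply: polynomial_inM].
Qed.
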